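(* For every integer $n\geqslant1$, the inequality \[f_n(s)\leqslant 2e^2(0.9214)^{n-1}h(s)\] holds for all $s\geqslant 1$ if $n$ is odd and for all $s\geqslant 2$ if $n$ is even.
   Context: $h(s)=e^{-2}$ for $1\leqslant s\leqslant 2$, $h(s)=e^{-s}$ for $2\leqslant s\leqslant 3$, $h(s)=3s^{-1}e^{-s}$ for $s\geqslant3$. The functions $f_n$ are defined by: $f_1(s)=(3-s)/s$ for $1\leqslant s\leqslant 3$ and $f_1(s)=0$ for $s>3$; for $n\geqslant 2$, if $n$ is even and $s\geqslant2$, or $n$ is odd and $s\geqslant3$, then $sf_n(s)=\int_s^\infty f_{n-1}(t-1)\,dt$; if $n$ is odd and $1\leqslant s\leqslant 3$ then $sf_n(s)=3f_n(3)$. *)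

(* Defs.v *)
From Stdlib Require Import Reals Arith.
From Coquelicot Require Import Coquelicot.
Open Scope R_scope.

(* Meaningful for s >= 1; the value below 1 is arbitrary. *)
Definition hsieve (s : R) : R :=
  if Rle_dec s 2 then exp (-2)
  else if Rle_dec s 3 then exp (- s)
  else 3 / s * exp (- s).

(* fsieve n is meaningful for n >= 1, on s >= 1 if n is odd and on s >= 2 if n is
   even; the recursion evaluates fsieve m on its own domain only, and the values
   elsewhere (including those of fsieve 0) are arbitrary.
   The total operator RInt_gen does not hide a convergence hypothesis: on its
   domain fsieve m is continuous and vanishes for s >= m + 2. *)
Fixpoint fsieve (n : nat) (s : R) {struct n} : R :=
  match n with
  | O => 0
  | S O => if Rle_dec s 3 then (3 - s) / s else 0
  | S m =>
      let g x :=
        RInt_gen (fun t => fsieve m (t - 1)) (at_point x) (Rbar_locally p_infty) / x in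
      if Nat.even n then g s
      else if Rle_dec 3 s then g s
      else 3 * g 3 / s
  end.

(* Main.v *)
(** Write [a = 0.9214] and let [k_n = h] for even [n], while for odd [n] let
    [k_n(s) = e^{-2}/s] on [[1,3]] and [k_n = h] beyond [3]; then [k_n <= h].
    By induction [f_n <= 2 e^2 a^{n-1} k_n], the step being
    [int_s^oo k_n(t-1) dt <= a s k_{n+1}(s)], where for odd [n + 1] the integral
    starts at [max(s,3)].  The sharper [k_n] exploits that
    [s f_n(s)] is constant on [[1,3]] for odd [n >= 3]; with [h] itself the step
    from odd to even [n] fails at [s = 2], where the ratio is [0.9607].
    For [s >= 3] it is enough that [k_n(x) <= e^{-x}] for [x >= 2] and [e <= 3a].
    The step at [s <= 3] to odd [n + 1] has a relative margin of [4e-5]; it rests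
    on a convergent of the continued fraction of [int_y^oo e^{-t}/t dt]. *)
Require Import Defs.
From Stdlib Require Import Reals Arith Lra Lia.
From Coquelicot Require Import Coquelicot.
Open Scope R_scope.

(** * Numerical inequalities for the exponential and the exponential integral *)

Lemma derive_nonneg_le (G g : R -> R) (a b : R) : a <= b ->
  (forall x, a <= x <= b -> is_derive G x (g x)) ->
  (forall x, a <= x <= b -> 0 <= g x) -> G a <= G b.
Proof.
  intros Hab HG Hg.
  destruct (MVT_gen G a b g) as [c [Hc E]].
  - rewrite Rmin_left, Rmax_right by lra; intros x Hx; apply HG; lra.
  - rewrite Rmin_left, Rmax_right by lra; intros x Hx.
    apply derivable_continuous_pt; exists (g x); apply is_derive_Reals, HG, Hx.
  - rewrite Rmin_left, Rmax_right in Hc by lra.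
    pose proof (Hg c Hc); nra.
Qed.

Lemma exp_1_upper : exp 1 <= 2.71833.
Proof.
  (* With [T] the Taylor polynomial, [exp (- x) * T x] has derivative [- exp (- x) * x^7 / 7!]. *)
  set (T x := 1 + x + x^2/2 + x^3/6 + x^4/24 + x^5/120 + x^6/720 + x^7/5040).
  pose proof (derive_nonneg_le (fun x => exp (- x) * T x + x^8 / 40320)
    (fun x => (1 - exp (- x)) * (x^7 / 5040)) 0 1) as H.
  (* The ends of [[0,1]] give [1 <= T(1)/e + 1/8!], that is [e (1 - 1/8!) <= T(1)]. *)
  assert (K : exp (- 0) * T 0 + 0^8 / 40320 <= exp (- (1)) * T 1 + 1^8 / 40320).
  { apply H; [lra| |].
    - intros x _; unfold T; auto_derive; [easy | field].
    - intros x Hx; apply Rmult_le_pos.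
      + enough (exp (- x) <= 1) by lra.
        rewrite exp_Ropp, <- Rinv_1; apply Rinv_le_contravar; [lra|].
        pose proof (exp_ineq1_le x); lra.
      + pose proof (pow_le x 7 (proj1 Hx)); lra. }
  rewrite Ropp_0, exp_0, exp_Ropp in K; unfold T in K.
  pose proof (exp_pos 1) as P.
  apply (Rmult_le_compat_r _ _ _ (Rlt_le _ _ P)) in K.
  replace ((/ exp 1 * (1 + 1 + 1^2/2 + 1^3/6 + 1^4/24 + 1^5/120 + 1^6/720 + 1^7/5040)
            + 1^8/40320) * exp 1)
    with (1 + 1 + 1^2/2 + 1^3/6 + 1^4/24 + 1^5/120 + 1^6/720 + 1^7/5040
            + 1^8/40320 * exp 1) in K by (field; lra).
  lra.
Qed.

(** [x e^{3-x} >= x (4-x) >= 3 >= e] on [[2,3]]. *)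
Lemma exp_minus_2_le_mul (x : R) : 2 <= x <= 3 -> exp (-2) <= x * exp (- x).
Proof.
  intros Hx.
  assert (Hw : exp 1 <= x * exp (3 - x)).
  { pose proof (exp_ineq1_le (3 - x)); pose proof exp_1_upper. nra. }
  replace (exp (-2)) with (exp 1 * exp (-3)) by (rewrite <- exp_plus; f_equal; ring).
  replace (exp (- x)) with (exp (3 - x) * exp (-3)) by (rewrite <- exp_plus; f_equal; ring).
  pose proof (exp_pos (-3)); nra.
Qed.

(** The step to even index on [[2,3]], divided by [c e^{-2}]: the leading 1 bounds the integral
    beyond 3, and the bracket is the integral of [1/(t-1)^2 + 1/4] over [[s,3]]. The cubic Taylor
    polynomial of [e^u], [u = 3-s], reduces it to a polynomial inequality. *)
Lemma even_step_numeric (s : R) : 2 <= s <= 3 ->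
  1 + (1 / (s - 1) - 1 / 2 + (3 - s) / 4) <= 0.9214 * (s * exp (2 - s)).
Proof.
  intros Hs; set (u := 3 - s).
  replace s with (3 - u) by (unfold u; ring).
  assert (Hu : 0 <= u <= 1) by (unfold u; lra); clearbody u; clear s Hs.
  pose proof (exp_ge_taylor u 3 (proj1 Hu)) as T; simpl in T.
  replace (2 - (3 - u)) with (u + - (1)) by ring; rewrite exp_plus, exp_Ropp.
  pose proof exp_1_upper as E; pose proof (exp_pos 1) as P.
  assert (I : 0.3389 <= 0.9214 * / exp 1).
  { apply Rmult_le_reg_r with (exp 1); [easy|].
    rewrite Rmult_assoc, Rinv_l by lra; lra. }
  set (e' := / exp 1) in *.
  assert (T' : 1 + u + u^2/2 + u^3/6 <= exp u) by lra.
  set (X := exp u) in *; clearbody X e'; clear E P T.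
  assert (A : 0.3389 * (1 + u + u^2/2 + u^3/6) <= 0.9214 * e' * X).
  { apply Rmult_le_compat; try lra.
    pose proof (pow_le u 2 (proj1 Hu)); pose proof (pow_le u 3 (proj1 Hu)); lra. }
  replace (1 + (1 / (3 - u - 1) - 1 / 2 + u / 4))
    with ((2 - u^2/4) / (2 - u)) by (field; lra).
  apply Rmult_le_reg_r with (2 - u); [lra|].
  replace ((2 - u^2/4) / (2 - u) * (2 - u)) with (2 - u^2/4) by (field; lra).
  apply Rle_trans with (0.3389 * (1 + u + u^2/2 + u^3/6) * ((3 - u) * (2 - u))).
  2: { replace (0.9214 * ((3 - u) * (X * e')) * (2 - u))
         with (0.9214 * e' * X * ((3 - u) * (2 - u))) by ring.
       apply Rmult_le_compat_r; [nra | easy]. }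
  (* The right side expands to [0.3389 (6 + u - u^2 - u^3/2 - u^4/3 + u^5/6)], so crude bounds on
     the powers leave a linear problem. *)
  assert (0 <= u^2 <= u) by nra.
  assert (0 <= u^3 <= u) by (simpl in *; nra).
  assert (0 <= u^4 <= u) by (simpl in *; nra).
  assert (0 <= u^5) by (apply pow_le; lra).
  lra.
Qed.

(* The ninth convergent of [1/(y+1/(1+1/(y+2/(1+2/(y+...)))))]; the odd ones lie above
   [e^y int_y^oo e^{-t}/t dt]. *)
Lemma exp_integral_majorant (y : R) : 0 < y ->
  is_derive (fun y => - (exp (- y) * ((y^4 + 19 * y^3 + 102 * y^2 + 154 * y + 24) /
                    (y^5 + 20 * y^4 + 120 * y^3 + 240 * y^2 + 120 * y)))) y
    (exp (- y) * (1 / y +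
       2880 / (y^5 + 20 * y^4 + 120 * y^3 + 240 * y^2 + 120 * y)^2)).
Proof.
  intros Hy.
  assert (0 < y^5 + 20 * y^4 + 120 * y^3 + 240 * y^2 + 120 * y).
  { assert (forall k, 0 < y ^ k) by (intros; apply pow_lt; easy).
    pose proof (H 5%nat); pose proof (H 4%nat); pose proof (H 3%nat); pose proof (H 2%nat); lra. }
  auto_derive; [simpl in *; lra | field; simpl in *; split; lra].
Qed.

(** * Continuity, and integrals of eventually vanishing functions *)

Lemma continuous_Rmax (f g : R -> R) (x : R) :
  continuous f x -> continuous g x -> continuous (fun x => Rmax (f x) (g x)) x.
Proof.
  intros Hf Hg.
  apply (continuous_ext (fun x => (f x + g x + Rabs (f x - g x)) * / 2)).
  { intros z; unfold Rabs, Rmax; destruct Rcase_abs, Rle_dec; simpl; lra. }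
  apply (continuous_mult (K := R_AbsRing)); [|apply continuous_const].
  apply (continuous_plus (V := R_NormedModule)).
  - apply (continuous_plus (V := R_NormedModule)); easy.
  - apply continuous_Rabs_comp, (continuous_minus (V := R_NormedModule)); easy.
Qed.

Lemma continuous_shift (f : R -> R) (a : R) :
  (forall x, continuous f x) -> forall x, continuous (fun t => f (t - a)) x.
Proof.
  intros Hf x; apply (continuous_comp (fun t => t - a) f); [|apply Hf].
  apply (ex_derive_continuous (K := R_AbsRing) (V := R_NormedModule)); auto_derive; easy.
Qed.

Lemma ex_RInt_cont (f : R -> R) (a b : R) : (forall x, continuous f x) -> ex_RInt f a b.
Proof. intros Hf; apply (ex_RInt_continuous (V := R_CompleteNormedModule)); auto. Qed.

(** [G x - RInt f a x] has derivative [g - f >= 0]; thus [g] itself need not be shown integrable. *)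
Lemma RInt_le_primitive (f G g : R -> R) (a b : R) : a <= b ->
  (forall x, continuous f x) ->
  (forall x, a <= x <= b -> is_derive G x (g x)) ->
  (forall x, a <= x <= b -> f x <= g x) ->
  RInt f a b <= G b - G a.
Proof.
  intros Hab Hf HG Hfg.
  assert (D : forall x, a <= x <= b ->
    is_derive (fun x => G x - RInt f a x) x (g x - f x)).
  { intros x Hx; apply (is_derive_minus (V := R_NormedModule)); [auto|].
    apply (is_derive_RInt f _ a); [|apply Hf].
    apply filter_forall; intros z.
    apply (RInt_correct (V := R_CompleteNormedModule)), ex_RInt_cont, Hf. }
  assert (L : G a - RInt f a a <= G b - RInt f a b).
  { apply (derive_nonneg_le (fun x => G x - RInt f a x) (fun x => g x - f x)); auto.
    intros x Hx; pose proof (Hfg x Hx); lra. }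
  rewrite RInt_point in L; change (zero : R) with 0 in L; lra.
Qed.

Lemma RInt_null (f : R -> R) (a b : R) :
  (forall x, Rmin a b < x < Rmax a b -> f x = 0) -> RInt f a b = 0.
Proof.
  intros H; rewrite (RInt_ext _ (fun _ => 0)) by exact H.
  rewrite RInt_const; apply Rmult_0_r.
Qed.

Lemma RInt_Chasles_cont (f : R -> R) (a b c : R) :
  (forall x, continuous f x) -> RInt f a b + RInt f b c = RInt f a c.
Proof.
  intros Hf; apply (RInt_Chasles (V := R_CompleteNormedModule)); apply ex_RInt_cont, Hf.
Qed.

(** Once the upper limit exceeds [max(a,B)] the proper integral no longer depends on it. The case
    [a > B] is included, both sides then being zero. *)
Lemma RInt_gen_vanishing (f g : R -> R) (a B : R) :
  (forall x, continuous g x) -> (forall x, B <= x -> g x = 0) ->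
  (forall x, a <= x -> f x = g x) ->
  RInt_gen f (at_point a) (Rbar_locally p_infty) = RInt g a B.
Proof.
  intros Hg Hz Hfg; apply is_RInt_gen_unique; intros P HP.
  apply (Filter_prod _ _ _ (fun x => x = a) (fun y => Rmax a B < y)).
  - reflexivity.
  - exists (Rmax a B); auto.
  - intros x y -> Hy; simpl; exists (RInt g a B); split; [|apply locally_singleton, HP].
    pose proof (Rmax_l a B); pose proof (Rmax_r a B).
    apply (is_RInt_ext g).
    + rewrite Rmin_left by lra; intros z Hz'; symmetry; apply Hfg, Rlt_le, Hz'.
    + replace (RInt g a B) with (RInt g a y).
      * apply (RInt_correct (V := R_CompleteNormedModule)), ex_RInt_cont, Hg.
      * rewrite <- (RInt_Chasles_cont g a B y Hg), (RInt_null g B y); [apply Rplus_0_r|].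
        rewrite Rmin_left by lra; intros z Hz'; apply Hz; lra.
Qed.

(** * The comparison functions [k_n] *)

Definition sieve_bound (n : nat) (s : R) : R :=
  if Nat.even n then hsieve s
  else if Rle_dec s 3 then exp (-2) / s else 3 / s * exp (- s).

Definition sieve_dom (n : nat) : R := if Nat.even n then 2 else 1.

Lemma hsieve_le_exp (x : R) : 2 <= x -> hsieve x <= exp (- x).
Proof.
  intros Hx; unfold hsieve; destruct Rle_dec; [|destruct Rle_dec].
  - replace (- x) with (-2) by lra; lra.
  - lra.
  - pose proof (exp_pos (- x)).
    assert (3 / x <= 1) by (apply Rle_div_l; lra). nra.
Qed.

Lemma sieve_bound_le_hsieve (n : nat) (x : R) : 1 <= x -> sieve_bound n x <= hsieve x.
Proof.
  intros Hx; unfold sieve_bound; destruct Nat.even; [lra|].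
  pose proof (exp_pos (-2)).
  unfold hsieve; destruct (Rle_dec x 3); destruct (Rle_dec x 2); try lra.
  - apply Rle_div_l; [lra|nra].
  - apply Rle_div_l; [lra|]. rewrite Rmult_comm; apply exp_minus_2_le_mul; lra.
Qed.

Lemma sieve_bound_le_exp (n : nat) (x : R) : 2 <= x -> sieve_bound n x <= exp (- x).
Proof.
  intros Hx; eapply Rle_trans; [apply sieve_bound_le_hsieve; lra | apply hsieve_le_exp; lra].
Qed.


(** * Integral estimates for the step from [m] to [m + 1] *)

Section Step.

Variables (m : nat) (F : R -> R) (c : R).
Hypotheses (Hm : (1 <= m)%nat) (Hc : 0 <= c) (Fcont : forall x, continuous F x)
  (Fnull : forall x, INR m + 2 <= x -> F x = 0)
  (Fle : forall x, sieve_dom m <= x -> F x <= c * sieve_bound m x).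

Let f t := F (t - 1).
(** The integrand [f] vanishes from [B] on, so [RInt f s B] stands for the integral up to
    infinity. *)
Let B := INR m + 3.

Let fcont : forall x, continuous f x := continuous_shift F 1 Fcont.

Let B_ge4 : 4 <= B.
Proof. unfold B; apply le_INR in Hm; simpl in Hm; lra. Qed.

Lemma step_tail_le (s : R) : 3 <= s -> RInt f s B <= c * exp (1 - s).
Proof.
  intros Hs.
  destruct (Rle_dec s B) as [HB|HB].
  - pose proof (exp_pos (1 - B)).
    enough (RInt f s B <= - (c * exp (1 - B)) - - (c * exp (1 - s))) by nra.
    apply (RInt_le_primitive f (fun t => - (c * exp (1 - t))) (fun t => c * exp (1 - t)));
      auto.
    + intros t Ht; auto_derive; [easy | unfold Rminus; ring].
    + intros t Ht; unfold f.
      eapply Rle_trans; [apply Fle; unfold sieve_dom; destruct Nat.even; lra|].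
      apply Rmult_le_compat_l; [easy|].
      replace (1 - t) with (- (t - 1)) by ring; apply sieve_bound_le_exp; lra.
  - rewrite RInt_null.
    + pose proof (exp_pos (1 - s)); nra.
    + rewrite Rmin_right by lra; intros x Hx; apply Fnull; unfold B in *; lra.
Qed.

Lemma step_le_ge3 (s : R) : 3 <= s -> RInt f s B <= 0.9214 * c * (3 * exp (- s)).
Proof.
  intros Hs; eapply Rle_trans; [apply step_tail_le, Hs|].
  replace (1 - s) with (1 + - s) by ring; rewrite exp_plus.
  pose proof exp_1_upper; pose proof (exp_pos (- s)).
  assert (0 <= c * exp (- s)) by nra; nra.
Qed.

(** Split at 3: the tail is at most [c e^{-2}], and on [[s,3]] the argument [t-1] lies in [[1,2]],
    where [k_m(y) = e^{-2}/y]. *)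
Lemma step_even_le (s : R) : Nat.even m = false -> 2 <= s <= 3 ->
  RInt f s B <= 0.9214 * c * (s * exp (- s)).
Proof.
  intros Hodd Hs.
  rewrite <- (RInt_Chasles_cont f s 3 B fcont).
  pose proof (step_tail_le 3 (Rle_refl 3)) as T.
  pose proof (exp_pos (-2)) as P.
  replace (1 - 3) with (-2) in T by ring.
  assert (H : RInt f s 3 <= c * exp (-2) * (- / (3 - 1) + 3 / 4)
                            - c * exp (-2) * (- / (s - 1) + s / 4)).
  { apply (RInt_le_primitive f (fun t => c * exp (-2) * (- / (t - 1) + t / 4))
             (fun t => c * exp (-2) * (/ (t - 1) ^ 2 + / 4))); auto; [lra| |].
    - intros t Ht; auto_derive; [lra | field; lra].
    - intros t Ht; unfold f.
      eapply Rle_trans; [apply Fle; unfold sieve_dom; rewrite Hodd; lra|].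
      unfold sieve_bound; rewrite Hodd; destruct Rle_dec as [_|]; [|lra].
      unfold Rdiv; rewrite Rmult_assoc; apply Rmult_le_compat_l; [easy|].
      apply Rmult_le_compat_l; [lra|].
      (* [1/y <= 1/y^2 + 1/4] is [0 <= (1/y - 1/2)^2]; it keeps logarithms out. *)
      rewrite <- pow_inv; pose proof (pow2_ge_0 (/ (t - 1) - / 2)); lra. }
  pose proof (even_step_numeric s Hs) as N.
  replace (exp (- s)) with (exp (-2) * exp (2 - s))
    by (rewrite <- exp_plus; f_equal; ring).
  assert (Q : 0 <= c * exp (-2)) by nra.
  apply (Rmult_le_compat_l _ _ _ Q) in N.
  replace (0.9214 * c * (s * (exp (-2) * exp (2 - s))))
    with (c * exp (-2) * (0.9214 * (s * exp (2 - s)))) by ring.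
  eapply Rle_trans; [|exact N].
  replace (1 / (s - 1)) with (/ (s - 1)) by (field; lra).
  nra.
Qed.

(** Split at 4: on [[3,4]] the bound [e^{-(t-1)}] integrates to [e^{-2} - e^{-3}]; beyond 4 there
    remains [3 int_3^oo e^{-y}/y dy], bounded by the convergent [N/D] at [y = 3]. *)
Lemma step_odd_le : Nat.even m = true -> RInt f 3 B <= 0.9214 * c * exp (-2).
Proof.
  intros Heven.
  rewrite <- (RInt_Chasles_cont f 3 4 B fcont).
  assert (H1 : RInt f 3 4 <= - (c * exp (1 - 4)) - - (c * exp (1 - 3))).
  { apply (RInt_le_primitive f (fun t => - (c * exp (1 - t))) (fun t => c * exp (1 - t)));
      auto; [lra| |].
    + intros t Ht; auto_derive; [easy | unfold Rminus; ring].
    + intros t Ht; unfold f.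
      eapply Rle_trans; [apply Fle; unfold sieve_dom; destruct Nat.even; lra|].
      apply Rmult_le_compat_l; [easy|].
      replace (1 - t) with (- (t - 1)) by ring; apply sieve_bound_le_exp; lra. }
  set (N y := y^4 + 19 * y^3 + 102 * y^2 + 154 * y + 24).
  set (D y := y^5 + 20 * y^4 + 120 * y^3 + 240 * y^2 + 120 * y).
  assert (H2 : RInt f 4 B <= 3 * c * - (exp (- (B - 1)) * (N (B - 1) / D (B - 1)))
                             - 3 * c * - (exp (- (4 - 1)) * (N (4 - 1) / D (4 - 1)))).
  { apply (RInt_le_primitive f
      (fun t => 3 * c * - (exp (- (t - 1)) * (N (t - 1) / D (t - 1))))
      (fun t => 3 * c * (exp (- (t - 1)) * (1 / (t - 1) + 2880 / D (t - 1) ^ 2)))); auto.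
    - intros t Ht.
      apply (is_derive_scal (fun t => - (exp (- (t - 1)) * (N (t - 1) / D (t - 1))))).
      replace (exp (- (t - 1)) * (1 / (t - 1) + 2880 / D (t - 1) ^ 2))
        with (1 * (exp (- (t - 1)) * (1 / (t - 1) + 2880 / D (t - 1) ^ 2))) by ring.
      apply (is_derive_comp (fun y => - (exp (- y) * (N y / D y))) (fun t => t - 1)).
      + apply exp_integral_majorant; lra.
      + auto_derive; [easy | ring].
    - intros t Ht; unfold f.
      eapply Rle_trans; [apply Fle; unfold sieve_dom; rewrite Heven; lra|].
      unfold sieve_bound; rewrite Heven.
      assert (h3 : hsieve (t - 1) = 3 / (t - 1) * exp (- (t - 1))).
      { unfold hsieve; destruct Rle_dec; [lra|]; destruct Rle_dec; [|easy].
        (* At [t = 4] the middle branch of [hsieve] applies, but both branches agree there. *)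
        replace (t - 1) with 3 by lra; field. }
      rewrite h3; pose proof (exp_pos (- (t - 1))).
      assert (0 <= 2880 / D (t - 1) ^ 2).
      { apply Rdiv_le_0_compat; [lra|]; apply pow_lt; unfold D.
        assert (forall k, 0 < (t - 1) ^ k) as p by (intros; apply pow_lt; lra).
        pose proof (p 5%nat); pose proof (p 4%nat); pose proof (p 3%nat);
        pose proof (p 2%nat); lra. }
      replace (3 * c * (exp (- (t - 1)) * (1 / (t - 1) + 2880 / D (t - 1) ^ 2)))
        with (c * (3 / (t - 1) * exp (- (t - 1)))
              + 3 * (c * exp (- (t - 1))) * (2880 / D (t - 1) ^ 2)) by (unfold Rdiv; ring).
      assert (0 <= c * exp (- (t - 1))) by nra.
      nra. }
  assert (H3 : 0 <= N (B - 1) / D (B - 1)).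
  { assert (forall k, 0 < (B - 1) ^ k) as p by (intros; apply pow_lt; lra).
    pose proof (p 5%nat); pose proof (p 4%nat); pose proof (p 3%nat); pose proof (p 2%nat).
    apply Rdiv_le_0_compat; [unfold N | unfold D]; lra. }
  pose proof (exp_pos (- (B - 1))).
  assert (H4 : 0 <= c * (exp (- (B - 1)) * (N (B - 1) / D (B - 1)))).
  { apply Rmult_le_pos; [easy|]; apply Rmult_le_pos; lra. }
  (* The left side is [5994/7623 = 0.7863046...]. *)
  assert (H5 : 3 * (N (4 - 1) / D (4 - 1)) <= 0.786305).
  { unfold N, D; lra. }
  replace (1 - 4) with (-3) in H1 by ring; replace (1 - 3) with (-2) in H1 by ring.
  replace (- (4 - 1)) with (-3) in H2 by ring.
  set (r := N (4 - 1) / D (4 - 1)) in *; clearbody r.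
  replace (exp (-2)) with (exp 1 * exp (-3)) in * by (rewrite <- exp_plus; f_equal; ring).
  pose proof (exp_pos (-3)); pose proof exp_1_upper as E.
  assert (Q : 0 <= c * exp (-3)) by nra.
  (* What is needed is [0.0786 e <= 1 - 3 r], about [0.21366 <= 0.213695]; an upper bound for [e]
     off by [5e-4] would not suffice. *)
  assert (c * exp (-3) * (exp 1 - 1 + 3 * r) <= c * exp (-3) * (0.9214 * exp 1)).
  { apply Rmult_le_compat_l; [easy | lra]. }
  lra.
Qed.

End Step.

(** * The recursion as a proper integral, and the induction *)

Lemma even_S (n : nat) : Nat.even (S n) = negb (Nat.even n).
Proof. rewrite Nat.even_succ, Nat.negb_even; reflexivity. Qed.

(** One formula serves both parities: for odd [S m] the lower limit is [max(s,3)], which encodes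
    [s f(s) = 3 f(3)] on [[1,3]]; for even [S m] it is [s]. The denominator [Rmax s 1] equals [s] on
    the domain and makes the formula continuous everywhere. *)
Lemma fsieve_rec (m : nat) (F : R -> R) (s : R) : (1 <= m)%nat ->
  (forall x, continuous F x) -> (forall x, INR m + 2 <= x -> F x = 0) ->
  (forall x, sieve_dom m <= x -> fsieve m x = F x) ->
  sieve_dom (S m) <= s ->
  fsieve (S m) s =
    RInt (fun t => F (t - 1)) (Rmax s (sieve_dom m + 1)) (INR m + 3) / Rmax s 1.
Proof.
  intros Hm Fcont Fnull HF Hs.
  assert (G : forall x, sieve_dom m + 1 <= x ->
    RInt_gen (fun t => fsieve m (t - 1)) (at_point x) (Rbar_locally p_infty)
    = RInt (fun t => F (t - 1)) x (INR m + 3)).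
  { intros x Hx; apply RInt_gen_vanishing.
    - apply continuous_shift, Fcont.
    - intros t Ht; apply Fnull; lra.
    - intros t Ht; apply HF; lra. }
  destruct m as [|m]; [lia|].
  change (fsieve (S (S m)) s) with
    (let g x := RInt_gen (fun t => fsieve (S m) (t - 1)) (at_point x)
                  (Rbar_locally p_infty) / x in
     if Nat.even (S (S m)) then g s else if Rle_dec 3 s then g s else 3 * g 3 / s).
  cbv zeta; unfold sieve_dom in *.
  rewrite (even_S (S m)) in *.
  destruct (Nat.even (S m)) in *; simpl negb in *; cbv iota in *.
  - rewrite (Rmax_left s 1) by lra.
    destruct Rle_dec.
    + rewrite Rmax_left by lra; rewrite G by lra; easy.
    + rewrite Rmax_right by lra; rewrite G by lra.
      replace (2 + 1) with 3 by ring; field; lra.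
  - rewrite !Rmax_left by lra; rewrite G by lra; easy.
Qed.

(** Continuity and vanishing are carried along with the bound so that the next improper integral
    converges. They are stated for a total function [F], since [fsieve n] is arbitrary off its
    domain. *)
Lemma fsieve_majorized (n : nat) : (1 <= n)%nat ->
  exists F : R -> R,
    (forall x, continuous F x) /\
    (forall x, INR n + 2 <= x -> F x = 0) /\
    (forall x, sieve_dom n <= x -> fsieve n x = F x) /\
    (forall x, sieve_dom n <= x -> F x <= 2 * exp 2 * 0.9214 ^ (n - 1) * sieve_bound n x).
Proof.
  induction n as [|m IH]; [lia|]; intros _.
  destruct (Nat.eq_dec m 0) as [->|Hm0].
  - clear IH; exists (fun s => Rmax (3 - s) 0 / Rmax s 1).
    split; [|split; [|split]].
    + intros x; apply (continuous_mult (K := R_AbsRing)).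
      * apply continuous_Rmax; [|apply continuous_const].
        apply (ex_derive_continuous (K := R_AbsRing) (V := R_NormedModule)); auto_derive; easy.
      * apply continuous_Rinv_comp.
        -- apply continuous_Rmax; [apply continuous_id | apply continuous_const].
        -- pose proof (Rmax_r x 1); lra.
    + intros x Hx; simpl in Hx; rewrite Rmax_right by lra; unfold Rdiv; ring.
    + unfold sieve_dom; simpl; intros x Hx; rewrite (Rmax_left x) by lra.
      destruct Rle_dec; [rewrite Rmax_left by lra; easy|].
      rewrite Rmax_right by lra; unfold Rdiv; ring.
    + unfold sieve_dom, sieve_bound; simpl; intros x Hx; rewrite (Rmax_left x) by lra.
      (* On [[1,3]] the claim becomes [(3-x)/x <= 2/x], with equality at [x = 1]; hence the constant
         [2 e^2]. *)
      assert (E : exp 2 * exp (-2) = 1) by (rewrite <- exp_plus, <- exp_0; f_equal; ring).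
      destruct Rle_dec.
      * rewrite Rmax_left by lra.
        replace (2 * exp 2 * 1 * (exp (-2) / x)) with (2 * (exp 2 * exp (-2)) / x)
          by (field; lra).
        rewrite E; apply Rmult_le_compat_r; [|lra].
        apply Rlt_le, Rinv_0_lt_compat; lra.
      * rewrite Rmax_right by lra.
        pose proof (exp_pos 2); pose proof (exp_pos (- x)).
        assert (0 < 3 / x) by (apply Rdiv_lt_0_compat; lra).
        unfold Rdiv at 1; rewrite Rmult_0_l.
        apply Rmult_le_pos; [lra|]; apply Rmult_le_pos; lra.
  - assert (Hm : (1 <= m)%nat) by lia.
    destruct (IH Hm) as [F [Fcont [Fnull [HF Fle]]]].
    pose (f t := F (t - 1)); pose (B := INR m + 3).
    assert (fcont : forall x, continuous f x) by apply continuous_shift, Fcont.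
    assert (HB : INR (S m) + 2 = B) by (rewrite S_INR; unfold B; ring).
    exists (fun s => RInt f (Rmax s (sieve_dom m + 1)) B / Rmax s 1).
    split; [|split; [|split]].
    + intros x; apply (continuous_mult (K := R_AbsRing)).
      * apply (continuous_comp (fun s => Rmax s (sieve_dom m + 1)) (fun y => RInt f y B)).
        -- apply continuous_Rmax; [apply continuous_id | apply continuous_const].
        -- apply (ex_derive_continuous (K := R_AbsRing) (V := R_NormedModule)).
           eexists; apply (is_derive_RInt' f _ _ B); [|apply fcont].
           apply filter_forall; intros z.
           apply (RInt_correct (V := R_CompleteNormedModule)), ex_RInt_cont, fcont.
      * apply continuous_Rinv_comp.
        -- apply continuous_Rmax; [apply continuous_id | apply continuous_const].
        -- pose proof (Rmax_r x 1); lra.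
    + rewrite HB; intros x Hx.
      rewrite RInt_null; [unfold Rdiv; ring|].
      pose proof (Rmax_l x (sieve_dom m + 1)).
      rewrite Rmin_right by lra; intros t Ht; apply Fnull; unfold B in *; lra.
    + intros x Hx; apply fsieve_rec; auto.
    + intros x Hx.
      set (c := 2 * exp 2 * 0.9214 ^ (m - 1)) in *.
      replace (2 * exp 2 * 0.9214 ^ (S m - 1)) with (0.9214 * c)
        by (unfold c; replace (S m - 1)%nat with (S (m - 1)) by lia; simpl; ring).
      assert (Hc : 0 <= c).
      { unfold c; pose proof (exp_pos 2); apply Rmult_le_pos; [lra|]; apply pow_le; lra. }
      assert (x1 : 1 <= x) by (unfold sieve_dom in Hx; destruct Nat.even; lra).
      rewrite (Rmax_left x 1) by lra; apply Rle_div_l; [lra|].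
      assert (Hge3 : forall y, 3 <= y -> RInt f y B <= 0.9214 * c * (3 * exp (- y)))
        by (intros y Hy; apply step_le_ge3; auto).
      unfold sieve_dom, sieve_bound in *.
      rewrite (even_S m) in *.
      destruct (Nat.even m) eqn:Em in *; simpl negb in *; cbv iota in *.
      * destruct Rle_dec.
        -- rewrite Rmax_right by lra.
           replace (0.9214 * c * (exp (-2) / x) * x) with (0.9214 * c * exp (-2))
             by (field; lra).
           replace (2 + 1) with 3 by ring.
           apply step_odd_le; auto; unfold sieve_dom, sieve_bound; rewrite Em; auto.
        -- rewrite Rmax_left by lra.
           replace (0.9214 * c * (3 / x * exp (- x)) * x)
             with (0.9214 * c * (3 * exp (- x))) by (field; lra).
           apply Hge3; lra.
      * rewrite Rmax_left by lra; unfold hsieve.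
        destruct Rle_dec; [|destruct Rle_dec].
        (* With [x >= 2], the first branch of [hsieve] is the single point 2. *)
        -- replace x with 2 by lra.
           rewrite Rmult_assoc, (Rmult_comm (exp (-2))).
           apply step_even_le; auto; try lra.
           unfold sieve_dom, sieve_bound; rewrite Em; auto.
        -- rewrite Rmult_assoc, (Rmult_comm (exp (- x))).
           apply step_even_le; auto; try lra.
           unfold sieve_dom, sieve_bound; rewrite Em; auto.
        -- replace (0.9214 * c * (3 / x * exp (- x)) * x)
             with (0.9214 * c * (3 * exp (- x))) by (field; lra).
           apply Hge3; lra.
Qed.

Theorem theorem8 :
  forall n : nat, (1 <= n)%nat ->
    (Nat.Odd n -> forall s : R, 1 <= s ->
       fsieve n s <= 2 * exp 2 * 0.9214 ^ (n - 1) * hsieve s) /\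
    (Nat.Even n -> forall s : R, 2 <= s ->
       fsieve n s <= 2 * exp 2 * 0.9214 ^ (n - 1) * hsieve s).
Proof.
  intros n Hn.
  destruct (fsieve_majorized n Hn) as [F [_ [_ [HF Fle]]]].
  assert (H : forall s, sieve_dom n <= s ->
    fsieve n s <= 2 * exp 2 * 0.9214 ^ (n - 1) * hsieve s).
  { intros s Hs; rewrite HF by easy.
    eapply Rle_trans; [apply Fle, Hs|].
    apply Rmult_le_compat_l.
    - pose proof (exp_pos 2); apply Rmult_le_pos; [lra|]; apply pow_le; lra.
    - apply sieve_bound_le_hsieve; unfold sieve_dom in Hs; destruct Nat.even; lra. }
  unfold sieve_dom in H; split; intros Hpar s Hs; apply H.
  - apply Nat.odd_spec in Hpar; rewrite <- Nat.negb_even in Hpar.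
    destruct Nat.even; [discriminate | easy].
  - apply Nat.even_spec in Hpar; rewrite Hpar; easy.
Qed.
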